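(* Let $X$, $X'$ be fibrewise pointed spaces over a topological space $B$. Let $\pi:E\to X$ and $\pi':E'\to X'$ be fibrewise fibrations over $B$ with fibres $F=\pi^{-1}(s_X(B))$ and $F'=(\pi')^{-1}(s_{X'}(B))$, respectively. Let $f,g:E\to E'$ be fibrewise maps and $\bar f,\bar g:X\to X'$ fibrewise pointed maps satisfying $\pi'\circ f=\bar f\circ\pi$ and $\pi'\circ g=\bar g\circ\pi$. Let $f_0=f|_F:F\to F'$ and $g_0=g|_F:F\to F'$ be the induced fibrewise maps between the fibres (note $f(F)\subset F'$ and $g(F)\subset F'$). Then $$D_B(f,g)+1\le (D_B(f_0,g_0)+1)\cdot(\mathrm{cat}_B^*(X)+1).$$
   Context: Fix a topological space $B$ and let $I=[0,1]$. A fibrewise space over $B$ is a space $X$ with a continuous map $p_X:X\to B$; a fibrewise map $f:X\to Y$ is a continuous map with $p_Y\circ f=p_X$; subspaces $U\subset X$ are fibrewise spaces via $p_X|_U$ (in particular $F\subset E$ is). Two fibrewise maps $f,g:X\to Y$ are fibrewise homotopic, $f\simeq_B g$, if there is a homotopy $H:X\times I\to Y$ from $f$ to $g$ with $p_Y(H(x,t))=p_X(x)$ for all $x,t$. A fibrewise pointed space is a fibrewise space $X$ with a section $s_X:B\to X$ of $p_X$; a fibrewise pointed map is a fibrewise map $f:X\to Y$ with $f\circ s_X=s_Y$. A fibrewise fibration is a fibrewise map $\pi:E\to X$ having the homotopy lifting property with respect to every fibrewise space: for every fibrewise space $Z$, fibrewise map $\phi:Z\to E$ and fibrewise homotopy $H:Z\times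 I\to X$ with $H(z,0)=\pi(\phi(z))$, there is a fibrewise homotopy $\tilde H:Z\times I\to E$ with $\tilde H(z,0)=\phi(z)$ and $\pi\circ\tilde H=H$. $D_B(f,g)$, for fibrewise maps $f,g:X\to Y$, is the smallest integer $n\ge 0$ such that $X$ has an open cover $\{U_0,\dots,U_n\}$ with $f|_{U_i}\simeq_B g|_{U_i}$ for all $i$ ($\infty$ if none exists). For a fibrewise pointed space $X$, $\mathrm{cat}_B^*(X)$ is the smallest integer $n\ge0$ such that $X$ has an open cover $\{U_0,\dots,U_n\}$ with $\mathrm{inc}_{U_i}\simeq_B s_X\circ p_X|_{U_i}$ for all $i$ ($\infty$ if none exists). *)

(* Defs.v *)
From HB Require Import structures.
From mathcomp Require Import all_boot all_order all_algebra.
From mathcomp Require Import all_classical all_reals all_analysis.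

Set Implicit Arguments.
Unset Strict Implicit.
Unset Printing Implicit Defensive.

Import Order.TTheory GRing.Theory Num.Theory.
Import numFieldNormedType.Exports.

Local Open Scope classical_set_scope.
Local Open Scope ring_scope.

Definition unit_interval (R : realType) : topologicalType :=
  set_type (`[0, 1]%classic : set R).

Lemma unit_interval0_subproof (R : realType) : (0 : R) \in (`[0, 1]%classic : set R).
Proof. by apply/mem_set; rewrite /= in_itv /= lexx ler01. Qed.

Lemma unit_interval1_subproof (R : realType) : (1 : R) \in (`[0, 1]%classic : set R).
Proof. by apply/mem_set; rewrite /= in_itv /= lexx ler01. Qed.

Definition I0 (R : realType) : unit_interval R :=
  exist _ 0 (unit_interval0_subproof R).
Definition I1 (R : realType) : unit_interval R :=
  exist _ 1 (unit_interval1_subproof R).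

Record fibSpace (B : topologicalType) : Type := FibSpace {
  fib_total :> topologicalType;
  fib_proj : fib_total -> B;
  fib_proj_continuous : continuous fib_proj }.

Record fibMap (B : topologicalType) (X Y : fibSpace B) : Type := FibMap {
  fib_fun :> X -> Y;
  fib_fun_continuous : continuous fib_fun;
  fib_fun_proj : forall x, fib_proj (fib_fun x) = fib_proj x }.

Record fibPointed (B : topologicalType) : Type := FibPointed {
  fib_space :> fibSpace B;
  fib_sect : B -> fib_space;
  fib_sect_continuous : continuous fib_sect;
  fib_sectK : forall b, fib_proj (fib_sect b) = b }.
Arguments fib_sect {B} f b.

Record fibPMap (B : topologicalType) (X Y : fibPointed B) : Type := FibPMap {
  fib_map :> fibMap X Y;
  fib_map_sect : forall b, fib_map (fib_sect X b) = fib_sect Y b }.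

Section Constructions.
Context {B : topologicalType}.
Implicit Types X Y Z : fibSpace B.

Lemma fib_comp_continuous X Y Z (g : fibMap Y Z) (f : fibMap X Y) :
  continuous (g \o f).
Proof.
move=> x; apply: continuous_comp; first exact: fib_fun_continuous.
exact: fib_fun_continuous.
Qed.

Lemma fib_comp_proj X Y Z (g : fibMap Y Z) (f : fibMap X Y) x :
  fib_proj ((g \o f) x) = fib_proj x.
Proof. by rewrite /= !fib_fun_proj. Qed.

Definition fib_comp X Y Z (g : fibMap Y Z) (f : fibMap X Y) : fibMap X Z :=
  FibMap (@fib_comp_continuous X Y Z g f) (@fib_comp_proj X Y Z g f).

Lemma fib_sub_continuous X (U : set X) :
  continuous (fun u : set_type U => fib_proj (set_val u)).
Proof.
move=> u; apply: (@continuous_comp (set_type U) X B set_val).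
  exact: initial_continuous.
exact: fib_proj_continuous.
Qed.

Definition fib_sub X (U : set X) : fibSpace B :=
  FibSpace (@fib_sub_continuous X U).

Lemma fib_incl_continuous X (U : set X) :
  continuous (set_val : fib_sub U -> X).
Proof. exact: initial_continuous. Qed.

Definition fib_incl X (U : set X) : fibMap (fib_sub U) X :=
  @FibMap B (fib_sub U) X set_val (@fib_incl_continuous X U) (fun=> erefl).

Definition fib_restr X Y (f : fibMap X Y) (U : set X) : fibMap (fib_sub U) Y :=
  fib_comp f (fib_incl U).

Section Corestriction.
Variables (X Y : fibSpace B) (f : fibMap X Y) (U : set X) (V : set Y).
Hypothesis fUV : forall x, U x -> V (f x).

Definition fib_corestr_fun (u : fib_sub U) : fib_sub V :=
  exist _ (f (set_val u)) (mem_set (fUV (set_valP u))).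

Lemma fib_corestr_continuous : continuous fib_corestr_fun.
Proof.
apply/continuousP => _ [W oW <-].
have := @fib_fun_continuous _ _ _ (fib_restr f U).
by move=> /continuousP /(_ W oW).
Qed.

Lemma fib_corestr_proj u : fib_proj (fib_corestr_fun u) = fib_proj u.
Proof. exact: fib_fun_proj. Qed.

Definition fib_corestr : fibMap (fib_sub U) (fib_sub V) :=
  FibMap fib_corestr_continuous fib_corestr_proj.

End Corestriction.

Lemma fib_cyl_continuous (R : realType) X :
  continuous (fun z : X * unit_interval R => fib_proj z.1).
Proof.
move=> z; apply: (@continuous_comp _ X B fst); first exact: cvg_fst.
exact: fib_proj_continuous.
Qed.

Definition fib_cyl (R : realType) X : fibSpace B :=
  FibSpace (@fib_cyl_continuous R X).

Definition fib_homotopic (R : realType) X Y (f g : fibMap X Y) : Prop :=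
  exists H : fibMap (fib_cyl R X) Y,
    forall x, H (x, I0 R) = f x /\ H (x, I1 R) = g x.

Definition fib_fibration (R : realType) (E X : fibSpace B)
    (pi : fibMap E X) : Prop :=
  forall (Z : fibSpace B) (phi : fibMap Z E) (H : fibMap (fib_cyl R Z) X),
    (forall z, H (z, I0 R) = pi (phi z)) ->
    exists Ht : fibMap (fib_cyl R Z) E,
      (forall z, Ht (z, I0 R) = phi z) /\ (forall zt, pi (Ht zt) = H zt).

Lemma fib_sect_proj_continuous (X : fibPointed B) :
  continuous (fib_sect X \o fib_proj (f:=X)).
Proof.
move=> x; apply: continuous_comp; first exact: fib_proj_continuous.
exact: fib_sect_continuous.
Qed.

Lemma fib_sect_proj_proj (X : fibPointed B) (x : X) :
  fib_proj ((fib_sect X \o fib_proj (f:=X)) x) = fib_proj x.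
Proof. exact: fib_sectK. Qed.

Definition fib_sect_proj (X : fibPointed B) : fibMap X X :=
  FibMap (@fib_sect_proj_continuous X) (@fib_sect_proj_proj X).

Definition fib_fibre (E : fibSpace B) (X : fibPointed B) (pi : fibMap E X) :
  set E := pi @^-1` range (fib_sect X).

Lemma fib_fibre_stable (E E' : fibSpace B) (X X' : fibPointed B)
    (pi : fibMap E X) (pi' : fibMap E' X') (f : fibMap E E')
    (fbar : fibPMap X X') (comm : forall e, pi' (f e) = fbar (pi e)) e :
  fib_fibre pi e -> fib_fibre pi' (f e).
Proof.
by move=> -[b _ be]; exists b => //; rewrite comm -be fib_map_sect.
Qed.

Definition fib_fibre_map (E E' : fibSpace B) (X X' : fibPointed B)
    (pi : fibMap E X) (pi' : fibMap E' X') (f : fibMap E E')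
    (fbar : fibPMap X X') (comm : forall e, pi' (f e) = fbar (pi e)) :
    fibMap (fib_sub (fib_fibre pi)) (fib_sub (fib_fibre pi')) :=
  fib_corestr (fib_fibre_stable comm).

End Constructions.

Definition min_or_infty (R : realType) (P : nat -> Prop) : \bar R :=
  if pselect (exists n, `[< P n >]) is left exP
  then (ex_minn exP)%:R%:E else +oo%E.

Definition open_cover_with (X : topologicalType) (P : set X -> Prop)
    (n : nat) : Prop :=
  exists U : 'I_n.+1 -> set X,
    [/\ forall i, open (U i), \bigcup_i U i = [set: X] & forall i, P (U i)].

Definition fib_distance (R : realType) (B : topologicalType)
    (X Y : fibSpace B) (f g : fibMap X Y) : \bar R :=
  min_or_infty R (open_cover_with
    (fun U : set X => fib_homotopic R (fib_restr f U) (fib_restr g U))).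

(* The homotopies in cat_B^* are fibrewise but not required to be pointed, and
   the open sets need not contain the section. *)
Definition fib_cat (R : realType) (B : topologicalType)
    (X : fibPointed B) : \bar R :=
  min_or_infty R (open_cover_with
    (fun U : set X =>
       fib_homotopic R (fib_incl U) (fib_restr (fib_sect_proj X) U))).

(* Main.v *)
Require Import Defs.
From mathcomp Require Import all_boot all_order all_algebra.
From mathcomp Require Import all_classical all_reals all_analysis.

(** The invariants count members of open covers, so it suffices to turn an
    open cover (V_i) of the fibre F on which the fibre maps f_0, g_0 are
    homotopic, and a categorical open cover (U_j) of X, into an open cover of
    E on which f and g are homotopic, indexed by the pairs (i, j).

    The contraction of U_j into the section, precomposed with pi, is a
    homotopy on pi^-1(U_j) which starts at pi composed with the inclusion.
    The lifting property of pi lifts it to a deformation in E of the inclusion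
    of pi^-1(U_j) into a map r_j with values in F ([fib_fibration_deform]).
    Let W_ij be the preimage of V_i under r_j; it is open in the open set
    pi^-1(U_j), hence in E.  On W_ij
      f ~ f r_j = f_0 r_j ~ g_0 r_j = g r_j ~ g,
    where the outer homotopies are the deformation followed by f and by g, and
    the middle one is the homotopy on V_i precomposed with r_j.  Every point e
    lies in pi^-1(U_j) for some j, and then r_j(e) lies in some V_i, so the
    W_ij cover E.

    The general tools are: fibrewise homotopy is symmetric, transitive, and
    stable under composition on both sides; and an inequality between minima
    that take the value +oo reduces to a statement about witnesses
    ([min_or_infty_mul]). *)

Set Implicit Arguments.
Unset Strict Implicit.
Unset Printing Implicit Defensive.

Import Order.TTheory GRing.Theory Num.Theory.
Import numFieldNormedType.Exports.

Local Open Scope classical_set_scope.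
Local Open Scope ring_scope.

(** * Maps into the unit interval *)

Section UnitInterval.
Variable R : realType.

Lemma continuous_set_type (S T : topologicalType) (A : set T)
    (f : S -> set_type A) :
  continuous (set_val \o f) -> continuous f.
Proof.
move=> /continuousP cf; apply/continuousP => _ [W oW <-].
exact: cf.
Qed.

Lemma clamp_subproof (t : R) :
  Num.max 0 (Num.min 1 t) \in (`[0, 1]%classic : set R).
Proof.
apply/mem_set; rewrite /= in_itv /= le_max lexx /= ge_max ler01 /=.
by rewrite ge_min lexx.
Qed.

(** The retraction of the line onto the unit interval.  Reparametrisations of
    homotopies are written as real functions followed by [clamp], which spares
    any proof that they stay within the interval. *)
Definition clamp (t : R) : unit_interval R :=
  exist _ (Num.max 0 (Num.min 1 t)) (clamp_subproof t).

Lemma clamp_continuous : continuous clamp.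
Proof.
apply: continuous_set_type => t.
apply: (@continuous_max R R (cst 0) (fun u : R => Num.min 1 u)).
  exact: cst_continuous.
apply: (@continuous_min R R (cst 1) id); first exact: cst_continuous.
exact: cvg_id.
Qed.

Lemma clamp_le0 t : t <= 0 -> clamp t = I0 R.
Proof.
move=> t0; apply: val_inj => /=.
by rewrite (min_idPr _) ?(max_idPl _) // (le_trans t0).
Qed.

Lemma clamp_ge1 t : 1 <= t -> clamp t = I1 R.
Proof.
by move=> t1; apply: val_inj => /=; rewrite (min_idPl _) // (max_idPr _).
Qed.

Lemma clampR_continuous (h : R -> R) : continuous h ->
  continuous (fun t : unit_interval R => clamp (h (set_val t))).
Proof.
move=> ch t; apply: (@continuous_comp _ R _ (h \o set_val) clamp).
  apply: (@continuous_comp _ R R set_val h); first exact: initial_continuous.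
  exact: ch.
exact: clamp_continuous.
Qed.

End UnitInterval.

(** * The calculus of fibrewise homotopies *)

Section Homotopy.
Variables (R : realType) (B : topologicalType).
Implicit Types X Y Z : fibSpace B.

Lemma fib_cyl_map_continuous Z Z' (k : fibMap Z Z')
    (c : unit_interval R -> unit_interval R) (cc : continuous c) :
  continuous (fun z : fib_cyl R Z => (k z.1, c z.2) : fib_cyl R Z').
Proof.
move=> z.
apply: (@cvg_pair _ _ _ _ (nbhs (k z.1)) (nbhs (c z.2))).
  apply: (@continuous_comp _ Z Z' fst k); first exact: cvg_fst.
  exact: fib_fun_continuous.
apply: (@continuous_comp _ (unit_interval R) _ snd c); first exact: cvg_snd.
exact: cc.
Qed.

Definition fib_cyl_map Z Z' (k : fibMap Z Z')
    (c : unit_interval R -> unit_interval R) (cc : continuous c) :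
    fibMap (fib_cyl R Z) (fib_cyl R Z') :=
  @FibMap B (fib_cyl R Z) (fib_cyl R Z') _ (@fib_cyl_map_continuous _ _ k c cc)
    (fun z => fib_fun_proj k z.1).

Definition fib_id Z : fibMap Z Z :=
  @FibMap B Z Z id (fun z => @cvg_id Z (nbhs z)) (fun=> erefl).

Lemma fib_slice_continuous Z (t : unit_interval R) :
  continuous (fun z : Z => (z, t) : fib_cyl R Z).
Proof.
move=> z; apply: (@cvg_pair _ _ _ _ (nbhs z) (nbhs t)).
  exact: cvg_id.
exact: cvg_cst.
Qed.

Definition fib_slice Z (t : unit_interval R) : fibMap Z (fib_cyl R Z) :=
  @FibMap B Z (fib_cyl R Z) _ (@fib_slice_continuous Z t) (fun=> erefl).

Lemma fib_homotopic_sym X Y (f g : fibMap X Y) :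
  fib_homotopic R f g -> fib_homotopic R g f.
Proof.
have crev : continuous (fun t : R => 1 - t).
  by move=> t; apply: cvgB; [exact: cvg_cst|exact: cvg_id].
move=> [H HP].
exists (fib_comp H (fib_cyl_map (fib_id X) (clampR_continuous crev))) => x /=.
rewrite clamp_ge1 ?subr0 // clamp_le0 ?subrr //.
by have [-> ->] := HP x.
Qed.

(** Away from the level m of tau the pasted map agrees locally with a or with
    b; at that level, where a and b have the same value, a neighbourhood that
    suits both of them suits the pasted map. *)
Lemma continuous_paste (T S : topologicalType) (tau : T -> R) (a b : T -> S)
    (m : R) :
  continuous tau -> continuous a -> continuous b ->
  (forall z, tau z = m -> a z = b z) ->
  continuous (fun z => if tau z <= m then a z else b z).
Proof.
move=> ctau ca cb ab z W /=.
case: (ltgtP (tau z) m) => [lt|gt|eq] nW.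
- have near_lt : \forall y \near z, tau y < m.
    exact: (ctau z) (lt_nbhsl lt).
  have near_W : \forall y \near z, W (a y) by exact: ca nW.
  change (\forall y \near z, W (if tau y <= m then a y else b y)).
  near=> y; rewrite ltW; last by near: y.
  by near: y.
- have near_gt : \forall y \near z, m < tau y.
    exact: (ctau z) (lt_nbhsr gt).
  have near_W : \forall y \near z, W (b y) by exact: cb nW.
  change (\forall y \near z, W (if tau y <= m then a y else b y)).
  near=> y; rewrite leNgt (_ : m < tau y) /=; last by near: y.
  by near: y.
- have near_Wa : \forall y \near z, W (a y) by exact: ca nW.
  have near_Wb : \forall y \near z, W (b y).
    by apply: (cb z); rewrite -ab.
  change (\forall y \near z, W (if tau y <= m then a y else b y)).
  by near=> y; case: ifP => _; near: y.
Unshelve. all: by end_near. Qed.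

(** The concatenation at time 1/2.  Both halves extend to the whole cylinder,
    because [clamp] holds the first one at its end and the second one at its
    start, so pasting needs no subspaces. *)
Lemma fib_homotopic_trans X Y (f g h : fibMap X Y) :
  fib_homotopic R f g -> fib_homotopic R g h -> fib_homotopic R f h.
Proof.
move=> [H HP] [K KP].
have c1 : continuous (fun t : R => t + t).
  by move=> t; apply: cvgD; exact: cvg_id.
have c2 : continuous (fun t : R => t + t - 1).
  by move=> t; apply: cvgB; [exact: c1|exact: cvg_cst].
pose a := fib_comp H (fib_cyl_map (fib_id X) (clampR_continuous c1)).
pose b := fib_comp K (fib_cyl_map (fib_id X) (clampR_continuous c2)).
have half2 : 2^-1 + 2^-1 = 1 :> R by rewrite [RHS]splitr !div1r.
have ctau : continuous (fun z : fib_cyl R X => set_val z.2).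
  move=> z; apply: (@continuous_comp _ (unit_interval R) R snd set_val).
    exact: cvg_snd.
  exact: initial_continuous.
have ab z : set_val z.2 = 2^-1 :> R -> a z = b z.
  move=> z2 /=; rewrite z2 half2 subrr clamp_ge1 // clamp_le0 //.
  by rewrite (HP _).2 (KP _).1.
have cpaste := continuous_paste ctau (@fib_fun_continuous _ _ _ a)
  (@fib_fun_continuous _ _ _ b) ab.
have ppaste (z : fib_cyl R X) :
    fib_proj (if set_val z.2 <= 2^-1 :> R then a z else b z) = fib_proj z.
  by case: ifP => _; exact: fib_fun_proj.
exists (FibMap cpaste ppaste) => x /=.
rewrite invr_ge0 ler0n addr0 clamp_le0 // (HP _).1; split=> //.
rewrite leNgt invf_lt1 ?ltr1n //= addrK clamp_ge1 //.
exact: (KP _).2.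
Qed.

Lemma fib_homotopic_precomp X Y Z (f g : fibMap X Y) (k : fibMap Z X) :
  fib_homotopic R f g -> fib_homotopic R (fib_comp f k) (fib_comp g k).
Proof.
move=> [H HP].
have cid : continuous (id : unit_interval R -> _) by move=> t; exact: cvg_id.
by exists (fib_comp H (fib_cyl_map k cid)) => z; exact: HP.
Qed.

Lemma fib_homotopic_postcomp X Y Z (f g : fibMap X Y) (k : fibMap Y Z) :
  fib_homotopic R f g -> fib_homotopic R (fib_comp k f) (fib_comp k g).
Proof.
by move=> [H HP]; exists (fib_comp k H) => x /=; have [-> ->] := HP x.
Qed.

(** Lets maps that agree pointwise be exchanged although their proofs of
    continuity differ. *)
Lemma fib_homotopic_eq X Y (f f' g g' : fibMap X Y) :
  f =1 f' -> g =1 g' -> fib_homotopic R f' g' -> fib_homotopic R f g.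
Proof. by move=> ff gg [H HP]; exists H => x; rewrite ff gg; exact: HP. Qed.

Lemma fib_lift_sub_continuous X Y (V : set Y) (f : fibMap X Y)
    (fV : forall x, V (f x)) :
  continuous (fun x => exist _ (f x) (mem_set (fV x)) : fib_sub V).
Proof. by apply: continuous_set_type; exact: fib_fun_continuous. Qed.

Definition fib_lift_sub X Y (V : set Y) (f : fibMap X Y)
    (fV : forall x, V (f x)) : fibMap X (fib_sub V) :=
  @FibMap B X (fib_sub V) _ (@fib_lift_sub_continuous _ _ _ _ fV)
    (fib_fun_proj f).

(** A contraction of U into the section, precomposed with pi, lifts to a
    deformation of the preimage of U in E.  The end of the lift projects into
    the section, that is, it lies in the fibre. *)
Lemma fib_fibration_deform (E : fibSpace B) (X : fibPointed B)
    (pi : fibMap E X) (U : set X) :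
  fib_fibration R pi ->
  fib_homotopic R (fib_incl U) (fib_restr (fib_sect_proj X) U) ->
  exists r : fibMap (fib_sub (pi @^-1` U)) (fib_sub (fib_fibre pi)),
    fib_homotopic R (fib_incl (pi @^-1` U)) (fib_comp (fib_incl _) r).
Proof.
move=> hpi [H HP].
pose q : fibMap (fib_sub (pi @^-1` U)) (fib_sub U) :=
  @fib_corestr B E X pi _ U (fun x Ux => Ux).
have cid : continuous (id : unit_interval R -> _) by move=> t; exact: cvg_id.
have [|G [G0 piG]] :=
  hpi _ (fib_incl (pi @^-1` U)) (fib_comp H (fib_cyl_map q cid)).
  by move=> z; rewrite /= (HP _).1.
have G1 z : fib_fibre pi (fib_comp G (fib_slice _ (I1 R)) z).
  exists (fib_proj (pi (set_val z))) => //=.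
  by rewrite piG /= (HP _).2.
by exists (fib_lift_sub G1), G => z; split; first exact: G0.
Qed.

End Homotopy.

(** * Sizes of covers *)

(** Covers indexed by any finite type, such as a type of pairs of indices, may
    be renumbered. *)
Lemma open_cover_withP (X : topologicalType) (P : set X -> Prop) (I : finType)
    (n : nat) (U : I -> set X) :
  #|I| = n.+1 -> (forall i, open (U i)) -> (forall x, exists i, U i x) ->
  (forall i, P (U i)) -> open_cover_with P n.
Proof.
move=> cI oU cU PU; exists (fun j => U (enum_val (cast_ord (esym cI) j))).
split=> //; apply/seteqP; split=> // x _; have [i Uix] := cU x.
exists (cast_ord cI (enum_rank i)) => //.
by rewrite cast_ordK enum_rankK.
Qed.

Section MinOrInfty.
Variable R : realType.

Lemma min_or_infty_le (P : nat -> Prop) n : P n ->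
  (min_or_infty R P <= n%:R%:E)%E.
Proof.
move=> Pn; rewrite /min_or_infty; case: pselect => [exP|].
  case: ex_minnP => m _ /(_ n) mn.
  by rewrite lee_fin ler_nat mn //; apply/asboolP.
by case; exists n; exact/asboolP.
Qed.

Variant min_or_infty_spec (P : nat -> Prop) : \bar R -> Prop :=
| MinFinite n of P n : min_or_infty_spec P n%:R%:E
| MinInfty : min_or_infty_spec P +oo%E.

Lemma min_or_inftyP (P : nat -> Prop) : min_or_infty_spec P (min_or_infty R P).
Proof.
rewrite /min_or_infty; case: pselect => [exP|_]; last exact: MinInfty.
by case: ex_minnP => n /asboolP Pn _; exact: MinFinite.
Qed.

(** The invariants are one less than the numbers of members of the covers;
    hence the successors and the predecessor. *)
Lemma min_or_infty_mul (P Q S : nat -> Prop) :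
  (forall m n, P m -> Q n -> S (m.+1 * n.+1).-1) ->
  (min_or_infty R S + 1 <= (min_or_infty R P + 1) * (min_or_infty R Q + 1))%E.
Proof.
move=> PQS.
(* The factors are positive, so an infinite one makes the product infinite. *)
have pos n : (0 < n%:R%:E + 1 :> \bar R)%E.
  by rewrite -EFinD lte_fin ltr_wpDl.
case: (min_or_inftyP P) => [m Pm|]; case: (min_or_inftyP Q) => [n Qn|].
- apply: (@le_trans _ _ ((m.+1 * n.+1).-1%:R%:E + 1)%E).
    by rewrite leeD2r // min_or_infty_le //; exact: PQS.
  by rewrite -!EFinD -EFinM lee_fin !natr1 -natrM.
- by rewrite addye // gt0_muley ?pos // leey.
- by rewrite addye // gt0_mulye ?pos // leey.
- by rewrite addye // mulyy leey.
Qed.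

End MinOrInfty.

(** * The inequality for maps between fibrations *)

Theorem theorem6p1 (R : realType) (B : topologicalType)
  (X X' : fibPointed B) (E E' : fibSpace B)
  (pi : fibMap E X) (pi' : fibMap E' X')
  (hpi : fib_fibration R pi) (hpi' : fib_fibration R pi')
  (f g : fibMap E E') (fbar gbar : fibPMap X X')
  (hf : forall e : E, pi' (f e) = fbar (pi e))
  (hg : forall e : E, pi' (g e) = gbar (pi e)) :
  (fib_distance R f g + 1 <=
   (fib_distance R (fib_fibre_map hf) (fib_fibre_map hg) + 1) *
   (fib_cat R X + 1))%E.
Proof.
apply: min_or_infty_mul => m n [V [oV cV hV]] [U [oU cU hU]].
pose P j := pi @^-1` U j.
have oP j : open (P j) by apply: open_comp => // e _; exact: fib_fun_continuous.
pose r j := sval (cid (fib_fibration_deform hpi (hU j))).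
have hr j : fib_homotopic R (fib_incl (P j)) (fib_comp (fib_incl _) (r j)).
  exact: (svalP (cid (fib_fibration_deform hpi (hU j)))).
pose W (ij : 'I_m.+1 * 'I_n.+1) : set E :=
  set_val @` (r ij.2 @^-1` V ij.1).
have WP ij e : W ij e -> P ij.2 e by case=> z _ <-; exact: set_valP.
apply: (@open_cover_withP _ _ ('I_m.+1 * 'I_n.+1)%type _ W).
- by rewrite card_prod !card_ord.
(* W is the trace on P of an open set of E, and P is open. *)
- move=> [i j]; have : open (r j @^-1` V i).
    by apply: open_comp => // z _; exact: fib_fun_continuous.
  move=> [G oG GV]; rewrite (_ : W _ = G `&` P j); first exact: openI.
  apply/seteqP; split=> [_ [z Vz <-]|e [Ge Pe]].
    split; last exact: set_valP.
    by move: Vz; rewrite -GV.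
  exists (exist _ e (mem_set Pe)) => //.
  by rewrite -GV.
- move=> e; have [j _ Uj] : (\bigcup_j U j) (pi e) by rewrite cU.
  pose z : fib_sub (P j) := exist _ e (mem_set Uj).
  have [i _ Vi] : (\bigcup_i V i) (r j z) by rewrite cV.
  by exists (i, j), z.
move=> ij.
(* On W, the inclusion into P followed by r takes its values in V. *)
pose w : fibMap (fib_sub (W ij)) (fib_sub (P ij.2)) :=
  @fib_corestr B E E (fib_id E) _ _ (WP ij).
have Vw z : V ij.1 (r ij.2 (w z)).
  have [y Vy yz] := set_valP z.
  by rewrite (_ : w z = y) //; exact/val_inj.
pose k := @fib_lift_sub _ _ _ (V ij.1) (fib_comp (r ij.2) w) Vw.
have deform (h : fibMap E E') :
    fib_homotopic R (fib_restr h (W ij))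
      (fib_comp h (fib_comp (fib_comp (fib_incl (fib_fibre pi)) (r ij.2)) w)).
  apply: (fib_homotopic_postcomp h (f := fib_incl (W ij))).
  exact: (fib_homotopic_precomp w (hr ij.2)).
apply: fib_homotopic_trans (deform f) _.
apply: fib_homotopic_trans (fib_homotopic_sym (deform g)).
have := fib_homotopic_precomp k (hV ij.1).
move/(fib_homotopic_postcomp (fib_incl (fib_fibre pi'))).
exact: fib_homotopic_eq.
Qed.
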